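(* Let $\gamma: V\otimes H_o\to H_o\otimes V$ be a linear map of the form $\gamma(e_i\otimes T_j^k)=\gamma_{ijn}^{klm}\,T_l^n\otimes e_m$ with $\gamma_{ijn}^{klm}\in\mathbb{C}$, and let $$\delta_{V\otimes V}^{\gamma}=(m\otimes I_{V\otimes V})\,(I_{H_o}\otimes\gamma\otimes I_V)\,(\delta_V\otimes\delta_V): V\otimes V\to H_o\otimes V\otimes V .$$ Then $\delta^\gamma_{V\otimes V}$ is a coaction turning $V\otimes V$ into a left $H_o$-comodule, i.e. $$(\Delta\otimes I_{V\otimes V})\circ\delta^\gamma_{V\otimes V}=(I_{H_o}\otimes\delta^\gamma_{V\otimes V})\circ\delta^\gamma_{V\otimes V},\qquad (\varepsilon\otimes I_{V\otimes V})\circ\delta^\gamma_{V\otimes V}=I_{V\otimes V},$$ if and only if there exist scalars $\theta_{jn}^{kl}\in\mathbb{C}$ such that for all values of the free indices $$\gamma_{ijn}^{klm}=\delta_i^m\,\theta_{jn}^{kl},\qquad \theta_{ij}^{pl}\,\theta_{pk}^{rs}-\delta_j^s\,\theta_{ik}^{rl}=0,\qquad \theta_{jn}^{kn}=\delta_j^k .$$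
   Context: All indices run from $1$ to $n$; summation over repeated indices is assumed; $\delta_i^j$ with two indices is the Kronecker delta. $V$ is a complex vector space of dimension $n$ with basis $\{e_i\}$. $H_o$ is the free associative unital $\mathbb{C}$-algebra on generators $T_i^j$, with product $m$, made into a bialgebra by the algebra homomorphisms $\Delta T_i^j=T_i^k\otimes T_k^j$ and $\varepsilon(T_i^j)=\delta_i^j$. The left coaction $\delta_V:V\to H_o\otimes V$ is $\delta_V(e_i)=T_i^j\otimes e_j$. Only the values of $\gamma$ on $e_i\otimes T_j^k$ enter the definition of $\delta^\gamma_{V\otimes V}$. *)

(* Defs.v *)
From HB Require Import structures.
From mathcomp Require Import all_boot all_order all_algebra.

From mathcomp.classical Require Import boolp.
From mathcomp Require Import finmap monalg.

Set Implicit Arguments.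
Unset Strict Implicit.
Unset Printing Implicit Defensive.

Import GRing.Theory.
Local Open Scope ring_scope.
Local Open Scope quotient_scope.

Local Notation is_bilinear :=
  (bilinear_for (GRing.Scale.Law.clone _ _ ( *:%R) _)
                (GRing.Scale.Law.clone _ _ ( *:%R) _)).

(* Linear extension of h to the free K-module on X. *)
Section FreeModule.
Variables (K : fieldType) (X : choiceType) (M : lmodType K) (h : X -> M).

Definition malg_lin (x : {malg K[X]}) : M := \sum_(k <- msupp x) x@_k *: h k.

Lemma malg_linEw (d : {fset X}) (x : {malg K[X]}) :
  fsubset (msupp x) d -> malg_lin x = \sum_(k <- d) x@_k *: h k.
Proof.
move=> le; rewrite [LHS](big_fset_incl _ le) //= => k _ /mcoeff_outdom ->.
by rewrite scale0r.
Qed.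

Lemma malg_linP : linear malg_lin.
Proof.
move=> a x y; pose d := fsetU (msupp x) (msupp y).
have xd : fsubset (msupp x) d by exact: fsubsetUl.
have yd : fsubset (msupp y) d by exact: fsubsetUr.
have ad : fsubset (msupp (a *: x + y)) d.
  apply: (fsubset_trans (msuppD_le _ _)); apply/fsubsetP => k.
  rewrite !in_fsetU => /orP[kx|->]; last by rewrite orbT.
  by rewrite (fsubsetP (msuppZ_le a x) k kx).
rewrite (malg_linEw xd) (malg_linEw yd) (malg_linEw ad) scaler_sumr -big_split.
by apply: eq_bigr => k _; rewrite mcoeffD mcoeffZ scalerDl scalerA.
Qed.

HB.instance Definition _ := GRing.isLinear.Build K {malg K[X]} M _
  malg_lin malg_linP.

Lemma malg_linU k : malg_lin << k >> = h k.
Proof.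
by rewrite (malg_linEw msuppU_le) big_seq_fset1 mcoeffUU scale1r.
Qed.

End FreeModule.

Lemma malg_ext (K : fieldType) (X : choiceType) (M : lmodType K)
    (f g : {linear {malg K[X]} -> M}) :
  (forall k, f << k >> = g << k >>) -> f =1 g.
Proof.
move=> fg x; rewrite [x]monalgE !linear_sum; apply: eq_bigr => k _.
have -> : << x@_k *g k >> = x@_k *: << k >>.
  by apply/malgP => l; rewrite mcoeffZ !mcoeffU mulrnAr mulr1.
by rewrite !linearZ fg.
Qed.

(* The tensor product U (x) V: the free K-module on the set U * V modulo the  *)
(* submodule generated by the bilinearity relations.                          *)
Section Tensor.
Variables (K : fieldType) (U V : lmodType K).

Local Notation F := {malg K[(U * V)%type]}.

Inductive bilinear_relation : F -> Prop :=
| bilinear_relation0 : bilinear_relation 0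
| bilinear_relationP a x y : bilinear_relation x -> bilinear_relation y ->
    bilinear_relation (a *: x + y)
| bilinear_relationL a u u' v : bilinear_relation
    (<< (a *: u + u', v) >> - (a *: << (u, v) >> + << (u', v) >>))
| bilinear_relationR a u v v' : bilinear_relation
    (<< (u, a *: v + v') >> - (a *: << (u, v) >> + << (u, v') >>)).

Definition bilinear_relations : pred F := fun x => `[< bilinear_relation x >].

Lemma bilinear_relations_zmod : zmod_closed bilinear_relations.
Proof.
split=> [|x y /asboolP rx /asboolP ry]; apply/asboolP.
  exact: bilinear_relation0.
by rewrite addrC -scaleN1r; apply: bilinear_relationP.
Qed.

HB.instance Definition _ := GRing.isZmodClosed.Build F bilinear_relations
  bilinear_relations_zmod.

Local Notation quotF :=
  (Quotient.quot (GRing.ZmodClosed.clone F bilinear_relations _)).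

Definition tensor : Type := quotF.

HB.instance Definition _ := GRing.Zmodule.on tensor.

Definition tpi (x : F) : tensor := \pi_quotF x.

Lemma tpi_eq x y : bilinear_relation (x - y) <-> tpi x = tpi y.
Proof.
split=> [r|/eqP]; last by rewrite -Quotient.idealrBE => /asboolP.
by apply/eqP; rewrite -Quotient.idealrBE; apply/asboolP.
Qed.

Lemma tpiB x y : tpi (x - y) = tpi x - tpi y.
Proof. exact: raddfB. Qed.

Lemma tpiD x y : tpi (x + y) = tpi x + tpi y.
Proof. exact: raddfD. Qed.

Lemma tpi_repr (t : tensor) : tpi (repr (t : quotF)) = t.
Proof. exact: reprK. Qed.

Lemma tpi_ind (P : tensor -> Prop) : (forall x, P (tpi x)) -> forall t, P t.
Proof. by move=> H t; rewrite -(tpi_repr t). Qed.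

Definition tensor_scale (a : K) (t : tensor) : tensor :=
  tpi (a *: repr (t : quotF)).

Lemma tensor_scale_pi a x : tensor_scale a (tpi x) = tpi (a *: x).
Proof.
apply/tpi_eq; rewrite -scalerBr -[X in bilinear_relation X]addr0.
apply: bilinear_relationP; last exact: bilinear_relation0.
by apply/tpi_eq; rewrite tpi_repr.
Qed.

Lemma tensor_scaleA a b t :
  tensor_scale a (tensor_scale b t) = tensor_scale (a * b) t.
Proof. by elim/tpi_ind: t => x; rewrite !tensor_scale_pi scalerA. Qed.

Lemma tensor_scale1 t : tensor_scale 1 t = t.
Proof. by elim/tpi_ind: t => x; rewrite tensor_scale_pi scale1r. Qed.

Lemma tensor_scaleDr a s t :
  tensor_scale a (s + t) = tensor_scale a s + tensor_scale a t.
Proof.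
elim/tpi_ind: s => x; elim/tpi_ind: t => y.
by rewrite -tpiD !tensor_scale_pi scalerDr tpiD.
Qed.

Lemma tensor_scaleDl t a b :
  tensor_scale (a + b) t = tensor_scale a t + tensor_scale b t.
Proof. by elim/tpi_ind: t => x; rewrite !tensor_scale_pi scalerDl tpiD. Qed.

HB.instance Definition _ := GRing.Zmodule_isLmodule.Build K tensor
  tensor_scaleA tensor_scale1 tensor_scaleDr tensor_scaleDl.

Lemma tpiZ a x : tpi (a *: x) = a *: tpi x.
Proof. by rewrite -tensor_scale_pi. Qed.

(* Locked so that failing conversion tests never unfold the quotient. *)
Fact tensor_key : unit. Proof. exact: tt. Qed.

Definition tens : U -> V -> tensor :=
  locked_with tensor_key (fun u v => tpi << (u, v) >>).

Lemma tensE u v : tens u v = tpi << (u, v) >>.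
Proof. by rewrite /tens unlock. Qed.

Lemma tens_bilinear : is_bilinear tens.
Proof.
split=> [v a u u'|u a v v']; rewrite /= !tensE -tpiZ -tpiD; apply/tpi_eq.
  exact: bilinear_relationL.
exact: bilinear_relationR.
Qed.

HB.instance Definition _ := bilinear_isBilinear.Build K U V tensor _ _
  tens tens_bilinear.

Lemma tensPl a u u' v : tens (a *: u + u') v = a *: tens u v + tens u' v.
Proof. exact: tens_bilinear.1. Qed.

Lemma tensPr a u v v' : tens u (a *: v + v') = a *: tens u v + tens u v'.
Proof. exact: tens_bilinear.2. Qed.

Lemma tensZl a u v : tens (a *: u) v = a *: tens u v.
Proof. exact: linearZl_LR. Qed.

Lemma tensZr a u v : tens u (a *: v) = a *: tens u v.
Proof. exact: linearZr_LR. Qed.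

Lemma tens_suml I r (P : pred I) (E : I -> U) v :
  tens (\sum_(i <- r | P i) E i) v = \sum_(i <- r | P i) tens (E i) v.
Proof. exact: linear_sumlz. Qed.

Lemma tens_sumr I r (P : pred I) u (E : I -> V) :
  tens u (\sum_(i <- r | P i) E i) = \sum_(i <- r | P i) tens u (E i).
Proof. exact: linear_sumr. Qed.

Lemma tensor_ext (W : lmodType K) (f g : {linear tensor -> W}) :
  (forall u v, f (tens u v) = g (tens u v)) -> f =1 g.
Proof.
move=> fg; elim/tpi_ind => x; rewrite [x]monalgE.
have -> : tpi (\sum_(k <- msupp x) << x@_k *g k >>)
    = \sum_(k <- msupp x) x@_k *: tens k.1 k.2.
  rewrite [LHS]raddf_sum; apply: eq_bigr => -[u v] _ /=; rewrite tensE -tpiZ.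
  congr (tpi _); apply/malgP => k.
  by rewrite mcoeffZ !mcoeffU mulrnAr mulr1.
by rewrite !linear_sum; apply: eq_bigr => k _; rewrite !linearZ fg.
Qed.

Section Lift.
Variables (W : lmodType K) (f : {bilinear U -> V -> W}).

Definition tensor_lift : tensor -> W := locked_with tensor_key
  (fun t => malg_lin (fun p : U * V => f p.1 p.2) (repr (t : quotF))).

Lemma tensor_lift_pi x :
  tensor_lift (tpi x) = malg_lin (fun p : U * V => f p.1 p.2) x.
Proof.
rewrite /tensor_lift unlock; suff null y : bilinear_relation y ->
    malg_lin (fun p : U * V => f p.1 p.2) y = 0.
  apply/eqP; rewrite -subr_eq0 -linearB; apply/eqP/null.
  by apply/tpi_eq; rewrite tpi_repr.
elim=> [|a z t _ z0 _ t0|a u u' v|a u v v']; first by rewrite linear0.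
- by rewrite linearP /= z0 t0 scaler0 addr0.
- by rewrite linearB linearP /= !malg_linU /= linearPl subrr.
- by rewrite linearB linearP /= !malg_linU /= linearPr subrr.
Qed.

Lemma tensor_lift_linear : linear tensor_lift.
Proof.
move=> a s t; elim/tpi_ind: s => x; elim/tpi_ind: t => y.
by rewrite -tpiZ -tpiD !tensor_lift_pi linearP.
Qed.

HB.instance Definition _ := GRing.isLinear.Build K tensor W _
  tensor_lift tensor_lift_linear.

Lemma tensor_liftE u v : tensor_lift (tens u v) = f u v.
Proof. by rewrite tensE tensor_lift_pi malg_linU. Qed.

End Lift.
End Tensor.

Arguments tensor {K} U V.
Arguments tens {K U V} u v.

Notation "U ⊗ V" := (tensor U%type V%type)
  (at level 40, left associativity) : type_scope.
Notation "u ⊗ v" := (tens u v)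
  (at level 40, left associativity) : ring_scope.

Section TensorMap.
Variables (K : fieldType) (U U' V V' : lmodType K).
Variables (f : {linear U -> U'}) (g : {linear V -> V'}).

Definition tensor_map_fun (u : U) (v : V) : U' ⊗ V' := f u ⊗ g v.

Lemma tensor_map_bilinear : is_bilinear tensor_map_fun.
Proof.
by split=> [v a u u'|u a v v'];
  rewrite /tensor_map_fun /= linearP ?tensPl ?tensPr.
Qed.

HB.instance Definition _ := bilinear_isBilinear.Build K U V (U' ⊗ V')%type _ _
  tensor_map_fun tensor_map_bilinear.

Definition tensor_map : U ⊗ V -> U' ⊗ V' := tensor_lift tensor_map_fun.

HB.instance Definition _ := GRing.Linear.on tensor_map.

Lemma tensor_mapE u v : tensor_map (u ⊗ v) = f u ⊗ g v.
Proof. exact: tensor_liftE. Qed.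

End TensorMap.

Arguments tensor_map {K U U' V V'} f g.

Section Associator.
Variables (K : fieldType) (U V W : lmodType K).

Definition assoc_fun2 (w : W) (u : U) (v : V) : U ⊗ (V ⊗ W) := u ⊗ (v ⊗ w).

Lemma assoc_fun2_bilinear w : is_bilinear (assoc_fun2 w).
Proof.
by split=> [v a u u'|u a v v'];
  rewrite /assoc_fun2 /= ?tensPl ?tensPr.
Qed.

HB.instance Definition _ w := bilinear_isBilinear.Build K U V (U ⊗ (V ⊗ W))%type _ _
  (assoc_fun2 w) (assoc_fun2_bilinear w).

Definition assoc_fun (t : U ⊗ V) (w : W) : U ⊗ (V ⊗ W) :=
  tensor_lift (assoc_fun2 w) t.

Lemma assoc_fun_bilinear : is_bilinear assoc_fun.
Proof.
split=> [w a s t|t a w w']; rewrite /assoc_fun; first exact: linearP.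
pose h := (a \*: tensor_lift (assoc_fun2 w)) \+ tensor_lift (assoc_fun2 w').
apply: (tensor_ext (g := h)) => u v.
by rewrite /h /= !tensor_liftE /= /assoc_fun2 !tensPr.
Qed.

HB.instance Definition _ :=
  bilinear_isBilinear.Build K (U ⊗ V)%type W (U ⊗ (V ⊗ W))%type _ _
  assoc_fun assoc_fun_bilinear.

Definition tassoc : (U ⊗ V) ⊗ W -> U ⊗ (V ⊗ W) := tensor_lift assoc_fun.

HB.instance Definition _ := GRing.Linear.on tassoc.

Lemma tassocE u v w : tassoc ((u ⊗ v) ⊗ w) = u ⊗ (v ⊗ w).
Proof. by rewrite /tassoc tensor_liftE /= /assoc_fun tensor_liftE. Qed.

Definition assocV_fun2 (u : U) (v : V) (w : W) : (U ⊗ V) ⊗ W := (u ⊗ v) ⊗ w.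

Lemma assocV_fun2_bilinear u : is_bilinear (assocV_fun2 u).
Proof.
by split=> [w a v v'|v a w w'];
  rewrite /assocV_fun2 /= !(tensPr, tensPl).
Qed.

HB.instance Definition _ u := bilinear_isBilinear.Build K V W ((U ⊗ V) ⊗ W)%type _ _
  (assocV_fun2 u) (assocV_fun2_bilinear u).

Definition assocV_fun (u : U) (t : V ⊗ W) : (U ⊗ V) ⊗ W :=
  tensor_lift (assocV_fun2 u) t.

Lemma assocV_fun_bilinear : is_bilinear assocV_fun.
Proof.
split=> [t a u u'|u a s t]; rewrite /assocV_fun; last exact: linearP.
pose h := (a \*: tensor_lift (assocV_fun2 u)) \+ tensor_lift (assocV_fun2 u').
apply: (tensor_ext (g := h)) => v w.
by rewrite /h /= !tensor_liftE /= /assocV_fun2 !tensPl.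
Qed.

HB.instance Definition _ :=
  bilinear_isBilinear.Build K U (V ⊗ W)%type ((U ⊗ V) ⊗ W)%type _ _
  assocV_fun assocV_fun_bilinear.

Definition tassocV : U ⊗ (V ⊗ W) -> (U ⊗ V) ⊗ W := tensor_lift assocV_fun.

HB.instance Definition _ := GRing.Linear.on tassocV.

Lemma tassocVE u v w : tassocV (u ⊗ (v ⊗ w)) = (u ⊗ v) ⊗ w.
Proof. by rewrite /tassocV tensor_liftE /= /assocV_fun tensor_liftE. Qed.

End Associator.

Arguments tassoc {K U V W}.
Arguments tassocV {K U V W}.

Section LeftUnitor.
Variables (K : fieldType) (V : lmodType K).

Definition unitl_fun (a : K^o) (v : V) : V := a *: v.

Lemma unitl_fun_bilinear : is_bilinear unitl_fun.
Proof.
split=> [v a b c|b a v w] /=; rewrite /unitl_fun.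
  by rewrite scalerDl -scalerA.
by rewrite scalerDr !scalerA mulrC.
Qed.

HB.instance Definition _ := bilinear_isBilinear.Build K K^o V V _ _
  unitl_fun unitl_fun_bilinear.

Definition tunitl : K^o ⊗ V -> V := tensor_lift unitl_fun.

HB.instance Definition _ := GRing.Linear.on tunitl.

Lemma tunitlE a v : tunitl (a ⊗ v) = a *: v.
Proof. exact: tensor_liftE. Qed.

End LeftUnitor.

Arguments tunitl {K V}.

Section AlgebraProduct.
Variables (K : fieldType) (A : algType K).

Definition mul_fun (a b : A) : A := a * b.

Lemma mul_fun_bilinear : is_bilinear mul_fun.
Proof.
split=> [b k a a'|a k b b'] /=; rewrite /mul_fun.
  by rewrite mulrDl scalerAl.
by rewrite mulrDr scalerAr.
Qed.

HB.instance Definition _ := bilinear_isBilinear.Build K A A A _ _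
  mul_fun mul_fun_bilinear.
HB.instance Definition _ a := GRing.isLinear.Build K A A _
  (mul_fun a) (mul_fun_bilinear.2 a).

Definition tmul : A ⊗ A -> A := tensor_lift mul_fun.

HB.instance Definition _ := GRing.Linear.on tmul.

Lemma tmulE a b : tmul (a ⊗ b) = a * b.
Proof. exact: tensor_liftE. Qed.

End AlgebraProduct.

Arguments tmul {K A}.

(* The tensor product algebra: (a (x) b) (a' (x) b') = a a' (x) b b'.  It is  *)
(* only registered as a pzRingType, since nothing is proved about 1 != 0.     *)
Section TensorAlgebra.
Variables (K : fieldType) (A B : algType K).

Definition tensor_mul_fun (y : A ⊗ B) (a : A) (b : B) : A ⊗ B :=
  tensor_map (mul_fun a) (mul_fun b) y.

Lemma tensor_mul_fun_bilinear y : is_bilinear (tensor_mul_fun y).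
Proof.
split=> [b k a a'|a k b b']; rewrite /tensor_mul_fun /=.
  pose h := (k \*: tensor_map (mul_fun a) (mul_fun b))
    \+ tensor_map (mul_fun a') (mul_fun b).
  apply: (tensor_ext (g := h)) => c d.
  by rewrite /h /= !tensor_mapE /= (fst (mul_fun_bilinear _)) tensPl.
pose h := (k \*: tensor_map (mul_fun a) (mul_fun b))
  \+ tensor_map (mul_fun a) (mul_fun b').
apply: (tensor_ext (g := h)) => c d.
by rewrite /h /= !tensor_mapE /= (fst (mul_fun_bilinear _)) tensPr.
Qed.

HB.instance Definition _ y := bilinear_isBilinear.Build K A B (A ⊗ B)%type _ _
  (tensor_mul_fun y) (tensor_mul_fun_bilinear y).

Definition tensor_mul (x y : A ⊗ B) : A ⊗ B :=
  tensor_lift (tensor_mul_fun y) x.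

Lemma tensor_mulE a b a' b' :
  tensor_mul (a ⊗ b) (a' ⊗ b') = (a * a') ⊗ (b * b').
Proof.
by rewrite /tensor_mul tensor_liftE /= /tensor_mul_fun tensor_mapE.
Qed.

Lemma tensor_mul_bilinear : is_bilinear tensor_mul.
Proof.
split=> [y k x x'|x k y y']; rewrite /tensor_mul /=; first by rewrite linearP.
pose h := (k \*: tensor_lift (tensor_mul_fun y))
  \+ tensor_lift (tensor_mul_fun y').
apply: (tensor_ext (g := h)) => a b.
by rewrite /h /= !tensor_liftE /= /tensor_mul_fun linearP.
Qed.

HB.instance Definition _ :=
  bilinear_isBilinear.Build K (A ⊗ B)%type (A ⊗ B)%type (A ⊗ B)%type _ _
  tensor_mul tensor_mul_bilinear.
HB.instance Definition _ x := GRing.isLinear.Build K (A ⊗ B)%type (A ⊗ B)%type _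
  (tensor_mul x) (tensor_mul_bilinear.2 x).

Lemma tensor_mulA : associative tensor_mul.
Proof.
move=> x y z; pose h1 := applyr tensor_mul (tensor_mul y z).
pose h2 := applyr tensor_mul z \o applyr tensor_mul y.
rewrite -[LHS]/(h1 x) -[RHS]/(h2 x); apply: tensor_ext => a b.
rewrite {x}/h1 {}/h2 /=.
pose h1 := tensor_mul (a ⊗ b) \o applyr tensor_mul z.
pose h2 := applyr tensor_mul z \o tensor_mul (a ⊗ b).
rewrite -[LHS]/(h1 y) -[RHS]/(h2 y); apply: tensor_ext => a' b'.
rewrite {y}/h1 {}/h2 /=.
pose h1 := tensor_mul (a ⊗ b) \o tensor_mul (a' ⊗ b').
pose h2 := tensor_mul (tensor_mul (a ⊗ b) (a' ⊗ b')).
rewrite -[LHS]/(h1 z) -[RHS]/(h2 z); apply: tensor_ext => a'' b''.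
by rewrite /h1 /h2 /= !tensor_mulE !mulrA.
Qed.

Lemma tensor_mul1 : left_id ((1 : A) ⊗ (1 : B)) tensor_mul.
Proof.
move=> x; pose h := tensor_mul (1 ⊗ 1).
rewrite -[LHS]/(h x) -[RHS]/(idfun x); apply: tensor_ext => a b.
by rewrite /h /= tensor_mulE !mul1r.
Qed.

Lemma tensor_1mul : right_id ((1 : A) ⊗ (1 : B)) tensor_mul.
Proof.
move=> x; pose h := applyr tensor_mul (1 ⊗ 1).
rewrite -[LHS]/(h x) -[RHS]/(idfun x); apply: tensor_ext => a b.
by rewrite /h /= tensor_mulE !mulr1.
Qed.

Lemma tensor_mulDl : left_distributive tensor_mul +%R.
Proof. by move=> x y z; rewrite linearDl. Qed.

Lemma tensor_mulDr : right_distributive tensor_mul +%R.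
Proof. by move=> x y z; rewrite linearDr. Qed.

HB.instance Definition _ := GRing.Zmodule_isPzRing.Build (A ⊗ B)%type
  tensor_mulA tensor_mul1 tensor_1mul tensor_mulDl tensor_mulDr.

Lemma mulr_tens (a a' : A) (b b' : B) :
  (a ⊗ b) * (a' ⊗ b') = (a * a') ⊗ (b * b').
Proof. exact: tensor_mulE. Qed.

End TensorAlgebra.

(* H_o, the free associative unital algebra on the T_i^j, realised as the     *)
(* monoid algebra of the free monoid on the pairs (i, j).                     *)
Section FreeBialgebra.
Variables (K : fieldType) (n : nat).

Definition Ho : Type := {malg K[{fmonom ('I_n * 'I_n)%type}]}.

HB.instance Definition _ := GRing.Lalgebra.on Ho.

Lemma Ho_scalerAr (a : K) (x y : Ho) : a *: (x * y) = x * (a *: y).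
Proof.
suff aC : a%:MP * x = x * a%:MP :> Ho.
  by rewrite -[LHS]mul_malgC -[a *: y]mul_malgC !mulrA aC.
rewrite [LHS]fgmulUg [RHS]fgmulgU; apply: eq_bigr => w _.
by rewrite mul1m mulm1 mulrC.
Qed.

HB.instance Definition _ := GRing.Lalgebra_isAlgebra.Build K Ho Ho_scalerAr.

Definition T (i j : 'I_n) : Ho := << fmu (i, j) >>.

(* The value of an algebra homomorphism on a basis word T_{i1}^{j1} ...       *)
(* T_{ir}^{jr} is the product of its values on the letters.                   *)
Definition coproduct : Ho -> Ho ⊗ Ho :=
  malg_lin (fun w : {fmonom ('I_n * 'I_n)%type} =>
    \prod_(t <- w) \sum_k (T t.1 k ⊗ T k t.2)).

HB.instance Definition _ := GRing.Linear.on coproduct.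

Definition counit : Ho -> K^o :=
  malg_lin (fun w : {fmonom ('I_n * 'I_n)%type} =>
    (\prod_(t <- w) (t.1 == t.2)%:R : K^o)).

HB.instance Definition _ := GRing.Linear.on counit.

Lemma coproductT i j : coproduct (T i j) = \sum_k (T i k ⊗ T k j).
Proof. by rewrite /coproduct malg_linU fmuE big_seq1. Qed.

Lemma coproduct1 : coproduct 1 = 1.
Proof. by rewrite /coproduct malg_linU fm1 big_nil. Qed.

Lemma counitT i j : counit (T i j) = (i == j)%:R.
Proof. by rewrite /counit malg_linU fmuE big_seq1. Qed.

Lemma counit1 : counit 1 = 1.
Proof. by rewrite /counit malg_linU fm1 big_nil. Qed.

Lemma Ho_ext (M : lmodType K) (f g : {linear Ho -> M}) :
  (forall w, f (<< w >> : Ho) = g (<< w >> : Ho)) -> f =1 g.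
Proof. exact: malg_ext. Qed.

Lemma coproductM x y : coproduct (x * y) = coproduct x * coproduct y.
Proof.
move: x; pose f := coproduct \o applyr (@mul_fun K Ho) y.
pose g := applyr (@tensor_mul K Ho Ho) (coproduct y) \o coproduct.
apply: (Ho_ext (f := f) (g := g)) => v; rewrite {}/f {}/g /=.
move: y; pose f := coproduct \o (@mul_fun K Ho << v >>).
pose g := (@tensor_mul K Ho Ho) (coproduct << v >>) \o coproduct.
apply: (Ho_ext (f := f) (g := g)) => w; rewrite {}/f {}/g /= /mul_fun.
have -> : << v >> * << w >> = << mmul v w >> :> Ho.
  by rewrite [LHS]fgmulUU mulr1.
by rewrite /coproduct !malg_linU fmM big_cat.
Qed.

Lemma counitM x y : counit (x * y) = counit x * counit y.
Proof.
move: x; pose f := counit \o applyr (@mul_fun K Ho) y.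
pose g := applyr (@mul_fun K K^o) (counit y) \o counit.
apply: (Ho_ext (f := f) (g := g)) => v; rewrite {}/f {}/g /=.
move: y; pose f := counit \o (@mul_fun K Ho << v >>).
pose g := (@mul_fun K K^o) (counit << v >>) \o counit.
apply: (Ho_ext (f := f) (g := g)) => w; rewrite {}/f {}/g /= /mul_fun.
have -> : << v >> * << w >> = << mmul v w >> :> Ho.
  by rewrite [LHS]fgmulUU mulr1.
by rewrite /counit !malg_linU fmM big_cat.
Qed.

End FreeBialgebra.

Arguments T {K n} i j.
Arguments coproduct {K n}.
Arguments counit {K n}.

Definition left_coaction (K : fieldType) (H M : lmodType K)
    (Delta : {linear H -> (H ⊗ H)%type}) (eps : {linear H -> K^o})
    (delta : {linear M -> (H ⊗ M)%type}) : Prop :=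
  tassoc \o tensor_map Delta idfun \o delta =1 tensor_map idfun delta \o delta
  /\ tunitl \o tensor_map eps idfun \o delta =1 idfun.

Section Coaction.
Variables (K : fieldType) (n : nat) (V : vectType K) (e : n.-tuple V).

Definition coaction (v : V) : Ho K n ⊗ V :=
  \sum_i coord e i v *: \sum_j (T i j ⊗ tnth e j).

Lemma coaction_linear : linear coaction.
Proof.
move=> a u v; rewrite /coaction scaler_sumr -big_split; apply: eq_bigr => i _.
by rewrite linearP scalerDl scalerA.
Qed.

HB.instance Definition _ := GRing.isLinear.Build K V (Ho K n ⊗ V)%type _
  coaction coaction_linear.

Lemma coactionE i : free e -> coaction (tnth e i) = \sum_j (T i j ⊗ tnth e j).
Proof.
move=> fe; rewrite /coaction (bigD1 i) //= {1}(tnth_nth 0) coord_free // eqxx.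
rewrite scale1r [X in _ + X]big1 ?addr0 // => k ki.
by rewrite {1}(tnth_nth 0) coord_free // eq_sym (negPf ki) scale0r.
Qed.

Variable gamma : {linear (V ⊗ Ho K n)%type -> (Ho K n ⊗ V)%type}.

(* (m (x) I) (I (x) gamma (x) I) (delta_V (x) delta_V), with the associators  *)
(* written out:                                                               *)
(*   (H V)(H V) -> H (V (H V)) -> H ((V H) V) -> H ((H V) V)                  *)
(*              -> H (H (V V)) -> (H H)(V V) -> H (V V).                      *)
Definition twisted_coaction : V ⊗ V -> Ho K n ⊗ (V ⊗ V) :=
  tensor_map tmul idfun \o tassocV \o tensor_map idfun tassoc
  \o tensor_map idfun (tensor_map gamma idfun)
  \o tensor_map idfun tassocV \o tassoc \o tensor_map coaction coaction.

HB.instance Definition _ := GRing.Linear.on twisted_coaction.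

End Coaction.

(* Main.v *)
Require Import Defs.
From HB Require Import structures.
From mathcomp Require Import all_boot all_order all_algebra.
From mathcomp Require Import reals complex.
From mathcomp Require Import monalg.

Set Implicit Arguments.
Unset Strict Implicit.
Unset Printing Implicit Defensive.

Import GRing.Theory.
Local Open Scope ring_scope.

(* Index the basis e_x of V (x) V by pairs x = (i, j) and write
   delta(e_x) = sum_y C_x^y (x) e_y.  Then delta is a coaction iff
   Delta C_x^y = sum_z C_x^z (x) C_z^y and eps C_x^y = [x = y].  The words
   W_u^v = T_{u1}^{v1} T_{u2}^{v2} are linearly independent and satisfy these
   same relations, so expanding C_x^y in them turns the coaction axioms into
     [c = m] [d = r] gamma_{ajq}^{blk}
       = sum_p gamma_{cjd}^{plm} gamma_{apq}^{brk},
     sum_q gamma_{ijq}^{kqm} = [i = m] [j = k],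
   and these scalar equations are equivalent to the existence of theta. *)

(** * Contraction of the right tensor factor with a functional *)

Section RightContraction.
Variables (K : fieldType) (U M : lmodType K) (phi : {linear M -> K^o}).

Definition contractr_fun (u : U) (m : M) : U := (phi m : K) *: u.

Lemma contractr_fun_bilinear :
  bilinear_for (GRing.Scale.Law.clone _ _ ( *:%R) _)
               (GRing.Scale.Law.clone _ _ ( *:%R) _) contractr_fun.
Proof.
split=> [m a u u'|u a m m'] /=; rewrite /contractr_fun.
  by rewrite scalerDr !scalerA mulrC.
by rewrite linearP scalerDl -scalerA.
Qed.

HB.instance Definition _ := bilinear_isBilinear.Build K U M U _ _
  contractr_fun contractr_fun_bilinear.

Definition contractr : U ⊗ M -> U := tensor_lift contractr_fun.

HB.instance Definition _ := GRing.Linear.on contractr.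

Lemma contractrE u m : contractr (u ⊗ m) = (phi m : K) *: u.
Proof. exact: tensor_liftE. Qed.

End RightContraction.

Arguments contractr {K U M} phi _.

(** Here [t] need not be a pure tensor; both sides are linear in [t], so pure tensors suffice for
    the check. *)
Lemma contractr_tassoc (K : fieldType) (U W M : lmodType K)
    (phi : {linear M -> K^o}) (t : (U ⊗ W)%type) (m : M) :
  tensor_map idfun (contractr phi) (tassoc (t ⊗ m)) = (phi m : K) *: t.
Proof.
pose f := tensor_map idfun (@contractr K W M phi) \o @tassoc K U W M
  \o applyr (@tens K (U ⊗ W)%type M) m.
pose h : {linear (U ⊗ W)%type -> (U ⊗ W)%type} := (phi m : K) \*: idfun.
rewrite -[LHS]/(f t) -[RHS]/(h t); apply: tensor_ext => u w.
by rewrite /f /h /= tassocE tensor_mapE /= contractrE tensZr.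
Qed.

(** * Linear independence through dual functionals *)

Section DualBasis.
Variables (K : fieldType) (P : finType).

(** This witness of linear independence makes sense in any module, with no finite dimension
    required, and passes to tensor products factor by factor. *)
Definition dual_family (M : lmodType K) (e : P -> M)
    (e' : P -> {linear M -> K^o}) : Prop :=
  forall x y, e' x (e y) = (x == y)%:R.

Lemma dual_family_sum (M : lmodType K) (e : P -> M)
    (e' : P -> {linear M -> K^o}) (c : P -> K) x :
  dual_family e e' -> e' x (\sum_y c y *: e y) = c x.
Proof.
move=> e'e; rewrite linear_sum (bigD1 x) //= linearZ /= e'e eqxx [_ *: _]mulr1.
rewrite big1 ?addr0 // => y yx; rewrite linearZ /= e'e eq_sym (negPf yx).
exact: scaler0.
Qed.

Lemma dual_family_inj (M : lmodType K) (e : P -> M)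
    (e' : P -> {linear M -> K^o}) (c d : P -> K) :
  dual_family e e' ->
  \sum_y c y *: e y = \sum_y d y *: e y -> forall x, c x = d x.
Proof.
move=> e'e cd x.
by rewrite -(dual_family_sum c x e'e) cd dual_family_sum.
Qed.

End DualBasis.

Lemma dual_family_tens (K : fieldType) (P Q : finType) (M N : lmodType K)
    (e : P -> M) e' (f : Q -> N) f' :
  dual_family e e' -> dual_family f f' ->
  dual_family (fun x : P * Q => e x.1 ⊗ f x.2)
    (fun x => tunitl \o tensor_map (e' x.1) (f' x.2)).
Proof.
move=> ee ff [x1 x2] [y1 y2] /=.
by rewrite tensor_mapE tunitlE ee ff /= [_ *: _]mulr_natl mulrb xpair_eqE; case: eqP.
Qed.

(** * The coaction axioms as equations between matrix entries *)

Section MatrixCoaction.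
Variables (K : fieldType) (P : finType) (H M : lmodType K).
Variables (Delta : {linear H -> (H ⊗ H)%type}) (eps : {linear H -> K^o}).
Variables (delta : {linear M -> (H ⊗ M)%type}).
Variables (e : P -> M) (e' : P -> {linear M -> K^o}) (C : P -> P -> H).
Hypotheses (e'e : dual_family e e')
           (e_gen : forall m, m = \sum_x (e' x m : K) *: e x)
           (deltaE : forall x, delta (e x) = \sum_y C x y ⊗ e y).

Lemma dual_basis_ext (N : lmodType K) (f h : {linear M -> N}) :
  (forall x, f (e x) = h (e x)) <-> f =1 h.
Proof.
split=> [fh m|fh x]; last exact: fh.
rewrite (e_gen m) !linear_sum; apply: eq_bigr => x _.
by rewrite !linearZ fh.
Qed.

(** Contracting the last tensor factor with [e' y] isolates the coefficient of [e y]. *)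
Lemma tassoc_dual_inj (c d : P -> (H ⊗ H)%type) :
  \sum_y tassoc (c y ⊗ e y) = \sum_y tassoc (d y ⊗ e y) ->
  forall y, c y = d y.
Proof.
have E y (b : P -> (H ⊗ H)%type) : tensor_map idfun (contractr (e' y))
    (\sum_x tassoc (b x ⊗ e x)) = b y.
  rewrite linear_sum (bigD1 y) //= contractr_tassoc e'e eqxx scale1r.
  rewrite big1 ?addr0 // => x xy.
  by rewrite contractr_tassoc e'e eq_sym (negPf xy) scale0r.
by move=> cd y; rewrite -(E y c) cd E.
Qed.

(** Each axiom equates two linear maps, so it can be tested on the [e x]. There both sides expand
    along the [e y], and the coefficients, in [H ⊗ H] or in [K], can be compared. *)
Lemma left_coaction_matrixP : left_coaction Delta eps delta <->
  (forall x y, Delta (C x y) = \sum_z C x z ⊗ C z y) /\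
  (forall x y, eps (C x y) = (x == y)%:R).
Proof.
have coassocl x : (tassoc \o tensor_map Delta idfun \o delta) (e x)
    = \sum_y tassoc (Delta (C x y) ⊗ e y).
  rewrite /= deltaE !linear_sum; apply: eq_bigr => y _.
  by rewrite /= tensor_mapE.
have coassocr x : (tensor_map idfun delta \o delta) (e x)
    = \sum_y tassoc ((\sum_z C x z ⊗ C z y) ⊗ e y).
  rewrite /= deltaE linear_sum /=.
  under eq_bigr => z _ do rewrite tensor_mapE /= deltaE tens_sumr.
  rewrite exchange_big; apply: eq_bigr => y _.
  rewrite tens_suml linear_sum; apply: eq_bigr => z _.
  by rewrite /= tassocE.
have counitl x : (tunitl \o tensor_map eps idfun \o delta) (e x)
    = \sum_y (eps (C x y) : K) *: e y.
  rewrite /= deltaE !linear_sum; apply: eq_bigr => y _.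
  by rewrite /= tensor_mapE /= tunitlE.
have eE x : e x = \sum_y (x == y)%:R *: e y.
  rewrite (bigD1 x) //= eqxx scale1r big1 ?addr0 // => y yx.
  by rewrite eq_sym (negPf yx) scale0r.
split=> [[coA coU]|[coA coU]].
  split=> x y.
    have := coA (e x); rewrite coassocl coassocr.
    by move/(tassoc_dual_inj (d := fun y => _)); apply.
  have := coU (e x); rewrite counitl [RHS]eE.
  by move/(dual_family_inj (d := fun y => _) e'e); apply.
split; apply/dual_basis_ext => x.
  by rewrite [LHS]coassocl [RHS]coassocr; apply: eq_bigr => y _; rewrite coA.
by rewrite [LHS]counitl [RHS]eE; apply: eq_bigr => y _; rewrite coU.
Qed.

End MatrixCoaction.

(** * Matrix entries expanded in an independent family *)

Section MatrixCoefficients.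
Variables (K : fieldType) (P : finType) (H : lmodType K).
Variables (Delta : {linear H -> (H ⊗ H)%type}) (eps : {linear H -> K^o}).
Variables (W : P -> P -> H) (W' : P * P -> {linear H -> K^o}).
Hypotheses (W'W : dual_family (fun u => W u.1 u.2) W')
           (DeltaW : forall u v, Delta (W u v) = \sum_z W u z ⊗ W z v)
           (epsW : forall u v, eps (W u v) = (u == v)%:R).
Variables (c : P -> P -> P -> P -> K).

Let C x y := \sum_u \sum_v c x y u v *: W u v.

Lemma coproduct_matrixP x y : Delta (C x y) = \sum_z C x z ⊗ C z y <->
  forall u v u' v', (v == u')%:R * c x y u v'
                    = \sum_z c x z u v * c z y u' v'.
Proof.
(* [A] and [B] are the coefficients of the two sides along [WW], which is independent because [W]
   is. The Kronecker factor in [A] appears because [DeltaW] only produces terms whose two middle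
   indices agree. *)
pose A (q : (P * P) * (P * P)) := (q.1.2 == q.2.1)%:R * c x y q.1.1 q.2.2.
pose B (q : (P * P) * (P * P)) :=
  \sum_z c x z q.1.1 q.1.2 * c z y q.2.1 q.2.2.
pose WW (q : (P * P) * (P * P)) := W q.1.1 q.1.2 ⊗ W q.2.1 q.2.2.
have sumE D : \sum_q D q *: WW q = \sum_u \sum_v \sum_u' \sum_v'
    D ((u, v), (u', v')) *: (W u v ⊗ W u' v').
  under [RHS]eq_bigr => u _ do under eq_bigr => v _ do rewrite pair_bigA /=.
  rewrite pair_bigA pair_bigA /=.
  by apply: eq_bigr => -[[u v] [u' v']].
have -> : Delta (C x y) = \sum_q A q *: WW q.
  rewrite sumE linear_sum; apply: eq_bigr => u _; rewrite linear_sum.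
  under eq_bigr => v' _ do rewrite linearZ /= DeltaW scaler_sumr.
  rewrite exchange_big; apply: eq_bigr => v _.
  rewrite [RHS](bigD1 v) //= [X in _ + X]big1 => [|u' u'v].
    by rewrite addr0; apply: eq_bigr => v' _; rewrite /A /= eqxx mul1r.
  by apply: big1 => v' _; rewrite /A /= eq_sym (negPf u'v) mul0r scale0r.
have -> : \sum_z C x z ⊗ C z y = \sum_q B q *: WW q.
  rewrite sumE.
  under eq_bigr => z _.
    rewrite /C tens_suml; under eq_bigr => u _.
      rewrite tens_suml; under eq_bigr => v _.
        rewrite tensZl tens_sumr scaler_sumr; under eq_bigr => u' _.
          rewrite tens_sumr scaler_sumr.
          under eq_bigr => v' _ do rewrite tensZr scalerA.
          over.
        over.
      over.
    over.
  rewrite exchange_big; apply: eq_bigr => u _.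
  rewrite exchange_big; apply: eq_bigr => v _.
  rewrite exchange_big; apply: eq_bigr => u' _.
  rewrite exchange_big; apply: eq_bigr => v' _.
  by rewrite /B /= scaler_suml.
split=> [AB u v u' v'|AB].
  exact: (dual_family_inj (dual_family_tens W'W W'W) AB ((u, v), (u', v'))).
by apply: eq_bigr => -[[u v] [u' v']] _; rewrite /A /= AB.
Qed.

Lemma counit_matrix x y : eps (C x y) = \sum_u c x y u u.
Proof.
rewrite linear_sum; apply: eq_bigr => u _; rewrite linear_sum (bigD1 u) //=.
rewrite linearZ /= epsW eqxx [_ *: _]mulr1 big1 ?addr0 // => v vu.
by rewrite linearZ /= epsW eq_sym (negPf vu) [_ *: _]mulr0.
Qed.

End MatrixCoefficients.

(** * Words of length two in the free algebra *)

Section QuadraticWords.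
Variables (K : fieldType) (n : nat).

Definition quadratic_word (u v : 'I_n * 'I_n) : Ho K n :=
  T u.1 v.1 * T u.2 v.2.

Definition word_coef (w : {fmonom ('I_n * 'I_n)%type}) : Ho K n -> K^o :=
  malg_lin (fun w' => (w == w')%:R : K^o).

HB.instance Definition _ w := GRing.Linear.on (word_coef w).

(** Different indices give different words of the free monoid, so reading off the coefficient of a
    word is the dual functional. *)
Lemma quadratic_word_dual : dual_family
  (fun u : ('I_n * 'I_n) * ('I_n * 'I_n) => quadratic_word u.1 u.2)
  (fun u => word_coef (mmul (fmu (u.1.1, u.2.1)) (fmu (u.1.2, u.2.2)))).
Proof.
move=> [[i l] [a q]] [[i' l'] [a' q']] /=; rewrite /quadratic_word /word_coef.
have -> : T i' a' * T l' q' =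
    << mmul (fmu (i', a')) (fmu (l', q')) >> :> Ho K n.
  by rewrite [LHS]fgmulUU mulr1.
rewrite malg_linU -val_eqE /= !fmM !fmuE /= !eqseq_cons !xpair_eqE andbT.
(* The word groups its indices by letters, as [(i, a)] and [(l, q)]; the index pairs group them as
   [(i, l)] and [(a, q)]. *)
by rewrite -!andbA [in LHS](andbCA (a == a')).
Qed.

Lemma coproduct_quadratic u v : coproduct (quadratic_word u v)
  = \sum_z quadratic_word u z ⊗ quadratic_word z v.
Proof.
rewrite /quadratic_word coproductM !coproductT mulr_suml.
under eq_bigr => k _ do rewrite mulr_sumr.
by rewrite pair_bigA; apply: eq_bigr => -[k l] _ /=; rewrite mulr_tens.
Qed.

Lemma counit_quadratic u v : counit (quadratic_word u v) = (u == v)%:R.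
Proof.
case: u v => [u1 u2] [v1 v2]; rewrite /quadratic_word counitM !counitT /=.
by rewrite xpair_eqE -natrM mulnb.
Qed.

End QuadraticWords.

(** * The product basis of the tensor square of [V] *)

Section Basis.
Variables (K : fieldType) (n : nat) (V : vectType K) (e : n.-tuple V).
Hypothesis e_basis : basis_of {:V} e.

Definition tens_basis (x : 'I_n * 'I_n) : V ⊗ V := tnth e x.1 ⊗ tnth e x.2.

(** The codomain is [K^o], so that [tunitl] can multiply two coordinates. *)
Definition coordo (i : 'I_n) (v : V) : K^o := coord e i v.

Lemma coordo_linear i : linear (coordo i).
Proof. by move=> a u v; rewrite /coordo linearP. Qed.

HB.instance Definition _ i := GRing.isLinear.Build K V K^o _
  (coordo i) (coordo_linear i).

Definition tens_coord (x : 'I_n * 'I_n) : V ⊗ V -> K^o :=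
  tunitl \o tensor_map (coordo x.1) (coordo x.2).

HB.instance Definition _ x := GRing.Linear.on (tens_coord x).

Lemma coordo_dual : dual_family (tnth e) coordo.
Proof.
move=> i j; rewrite /= /coordo (tnth_nth 0) coord_free ?(basis_free e_basis) //.
by rewrite eq_sym.
Qed.

Lemma tens_basis_dual : dual_family tens_basis tens_coord.
Proof. exact: (dual_family_tens coordo_dual coordo_dual). Qed.

Lemma tens_basis_gen t : t = \sum_x (tens_coord x t : K) *: tens_basis x.
Proof.
pose s := fun t : (V ⊗ V)%type => \sum_x (tens_coord x t : K) *: tens_basis x.
have s_lin : linear s.
  move=> a u v; rewrite /s scaler_sumr -big_split; apply: eq_bigr => x _.
  by rewrite linearP scalerDl scalerA.
(* The expansion is bundled as a linear map so that [tensor_ext] can compare it with the identity on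
   pure tensors. *)
pose sL := GRing.isLinear.Build K (V ⊗ V)%type (V ⊗ V)%type _ s s_lin.
pose S : {linear (V ⊗ V)%type -> (V ⊗ V)%type} := HB.pack s sL.
rewrite -[LHS]/(idfun t) -[RHS]/(S t); apply: tensor_ext => u v /=; rewrite /s.
have vE (w : V) : w = \sum_i coord e i w *: tnth e i.
  rewrite {1}(coord_basis e_basis (memvf w)).
  by apply: eq_bigr => i _; rewrite (tnth_nth 0).
rewrite {1}(vE u) tens_suml.
under eq_bigr => i _ do rewrite tensZl {1}(vE v) tens_sumr scaler_sumr.
rewrite pair_bigA; apply: eq_bigr => -[i j] _ /=.
by rewrite tensZr scalerA /tens_coord /= tensor_mapE tunitlE.
Qed.

End Basis.

Arguments quadratic_word K {n} u v.

(** * The product twisted by [gamma] *)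

Section TwistedProduct.
Variables (K : fieldType) (A : algType K) (V : lmodType K).
Variable gamma : {linear (V ⊗ A)%type -> (A ⊗ V)%type}.

(** The stage after [gamma]: [s] is its output, [h] and [w] are the outer factors that it leaves
    alone. *)
Definition mul_insert (h : A) (w : V) (s : A ⊗ V) : A ⊗ (V ⊗ V) :=
  tensor_map tmul idfun (tassocV (h ⊗ tassoc (s ⊗ w))).

Lemma mul_insert_linear h w : linear (mul_insert h w).
Proof.
move=> a s t; rewrite /mul_insert tensPl (linearP (@tassoc K A V V)) tensPr.
rewrite (linearP (@tassocV K A A (V ⊗ V)%type)).
by rewrite (linearP (tensor_map (@tmul K A) (@idfun (V ⊗ V)%type))).
Qed.

HB.instance Definition _ h w := GRing.isLinear.Build K (A ⊗ V)%type
  (A ⊗ (V ⊗ V))%type _ (mul_insert h w) (mul_insert_linear h w).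

Lemma mul_insertE h w t v : mul_insert h w (t ⊗ v) = (h * t) ⊗ (v ⊗ w).
Proof. by rewrite /mul_insert tassocE tassocVE tensor_mapE /= tmulE. Qed.

(** This is [twisted_coaction] without its first map, the tensor product of the two coactions. *)
Definition regroup : (A ⊗ V) ⊗ (A ⊗ V) -> A ⊗ (V ⊗ V) :=
  tensor_map tmul idfun \o tassocV \o tensor_map idfun tassoc
  \o tensor_map idfun (tensor_map gamma idfun)
  \o tensor_map idfun tassocV \o tassoc.

HB.instance Definition _ := GRing.Linear.on regroup.

Lemma regroupE h v t w :
  regroup ((h ⊗ v) ⊗ (t ⊗ w)) = mul_insert h w (gamma (v ⊗ t)).
Proof.
rewrite /regroup /= tassocE tensor_mapE /= tassocVE.
by rewrite tensor_mapE /= tensor_mapE /= tensor_mapE.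
Qed.

Lemma regroup_sum (I J : finType) (h : I -> A) (v : I -> V)
    (t : J -> A) (w : J -> V) :
  regroup ((\sum_i h i ⊗ v i) ⊗ (\sum_j t j ⊗ w j)) =
  \sum_i \sum_j mul_insert (h i) (w j) (gamma (v i ⊗ t j)).
Proof.
rewrite tens_suml linear_sum; apply: eq_bigr => i _.
by rewrite tens_sumr linear_sum; apply: eq_bigr => j _; rewrite -regroupE.
Qed.

Lemma mul_insert_sum (I J L : finType) h w (c : I -> J -> L -> K)
    (t : I -> J -> A) (v : L -> V) :
  mul_insert h w (\sum_i \sum_j \sum_l c i j l *: (t i j ⊗ v l)) =
  \sum_i \sum_j \sum_l c i j l *: ((h * t i j) ⊗ (v l ⊗ w)).
Proof.
rewrite linear_sum; apply: eq_bigr => i _.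
rewrite linear_sum; apply: eq_bigr => j _.
by rewrite linear_sum; apply: eq_bigr => l _; rewrite linearZ /= mul_insertE.
Qed.

End TwistedProduct.

(** The new order collects the indices as [y = (m, b)], then the free entry [l] of [u], then
    [v = (a, q)]. *)
Lemma exchange_big5 (A : zmodType) (I : finType)
    (F : I -> I -> I -> I -> I -> A) :
  \sum_a \sum_b \sum_l \sum_q \sum_m F a b l q m =
  \sum_m \sum_b \sum_l \sum_a \sum_q F a b l q m.
Proof.
rewrite exchange_big [RHS]exchange_big; apply: eq_bigr => b _.
rewrite exchange_big [RHS]exchange_big; apply: eq_bigr => l _.
rewrite [RHS]exchange_big; apply: eq_bigr => a _.
by rewrite exchange_big.
Qed.

(** * The twisted coaction in coordinates *)

Section TwistedCoaction.
Variables (K : fieldType) (n : nat) (V : vectType K) (e : n.-tuple V).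
Hypothesis e_basis : basis_of {:V} e.
Variable gamma : {linear (V ⊗ Ho K n)%type -> (Ho K n ⊗ V)%type}.
Variable g : 'I_n -> 'I_n -> 'I_n -> 'I_n -> 'I_n -> 'I_n -> K.
Hypothesis gammaE : forall i j k : 'I_n, gamma (tnth e i ⊗ T j k) =
  \sum_l \sum_q \sum_m g i j q k l m *: (T l q ⊗ tnth e m).

(** Coefficient of the word [W_u^v] in [C_x^y]. Its first letter comes straight from the coaction on
    the first basis vector, untouched by [gamma], hence the Kronecker factor. *)
Definition twist_coef (x y u v : 'I_n * 'I_n) : K :=
  (u.1 == x.1)%:R * g v.1 x.2 v.2 y.2 u.2 y.1.

Lemma twisted_coactionE x : twisted_coaction e gamma (tens_basis e x) =
  \sum_y (\sum_u \sum_v twist_coef x y u v *: quadratic_word K u v)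
         ⊗ tens_basis e y.
Proof.
case: x => i j; rewrite /twisted_coaction /tens_basis /= tensor_mapE /=.
rewrite !coactionE ?(basis_free e_basis) //.
transitivity (\sum_a \sum_b \sum_l \sum_q \sum_m g a j q b l m *:
    ((T i a * T l q) ⊗ (tnth e m ⊗ tnth e b))).
  rewrite -[LHS]/(regroup gamma _) regroup_sum.
  by apply: eq_bigr => a _; apply: eq_bigr => b _; rewrite gammaE mul_insert_sum.
rewrite exchange_big5.
rewrite pair_bigA; apply: eq_bigr => -[m b] _ /=.
rewrite -(pair_bigA _ (fun k l => \sum_v twist_coef (i, j) (m, b) (k, l) v *:
  quadratic_word K (k, l) v)) /=.
rewrite [in RHS](bigD1 i) //= [X in _ + X]big1 => [|k ki]; last first.
  apply: big1 => l _; apply: big1 => v _.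
  by rewrite /twist_coef /= (negPf ki) mul0r scale0r.
rewrite addr0 tens_suml; apply: eq_bigr => l _.
rewrite pair_bigA tens_suml; apply: eq_bigr => -[a q] _ /=.
by rewrite tensZl /twist_coef /= eqxx mul1r.
Qed.

(** The Kronecker factor of the second coefficient forces [z.1 = u'.1], so only [p = z.2] is
    summed. *)
Lemma twist_coef_mul x y u v u' v' :
  \sum_z twist_coef x z u v * twist_coef z y u' v' = (u.1 == x.1)%:R *
    \sum_p g v.1 x.2 v.2 p u.2 u'.1 * g v'.1 p v'.2 y.2 u'.2 y.1.
Proof.
rewrite -(pair_bigA _ (fun m p =>
  twist_coef x (m, p) u v * twist_coef (m, p) y u' v')) /=.
rewrite (bigD1 u'.1) //= [X in _ + X]big1 => [|m mu']; last first.
  by apply: big1 => p _; rewrite /twist_coef /= [u'.1 == m]eq_sym (negPf mu') mul0r mulr0.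
rewrite addr0 mulr_sumr; apply: eq_bigr => p _.
by rewrite /twist_coef /= eqxx mul1r mulrA.
Qed.

Lemma twist_coef_trace x y :
  \sum_u twist_coef x y u u = \sum_q g x.1 x.2 q y.2 q y.1.
Proof.
rewrite -(pair_bigA _ (fun k q => twist_coef x y (k, q) (k, q))) /=.
rewrite (bigD1 x.1) //= [X in _ + X]big1 => [|k kx]; last first.
  by apply: big1 => q _; rewrite /twist_coef /= (negPf kx) mul0r.
by rewrite addr0; apply: eq_bigr => q _; rewrite /twist_coef /= eqxx mul1r.
Qed.

Lemma left_coaction_twistedP :
  left_coaction coproduct counit (twisted_coaction e gamma) <->
  (forall a b c d j k l m q r, (c == m)%:R * (d == r)%:R * g a j q b l k
     = \sum_p g c j d p l m * g a p q b r k) /\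
  (forall i j k m, \sum_q g i j q k q m = (i == m)%:R * (j == k)%:R).
Proof.
rewrite (left_coaction_matrixP _ _ (tens_basis_dual e_basis)
  (tens_basis_gen e_basis) twisted_coactionE).
split=> [] [coA coU]; split.
- move=> a b c d j k l m q r.
  (* The first entry of [x] occurs only in the Kronecker factor; taking it equal to [u.1 = m] makes
     that factor 1. *)
  have /(coproduct_matrixP (@quadratic_word_dual K n)
    (@coproduct_quadratic K n)) := coA (m, j) (k, b).
  move/(_ (m, l) (c, d) (m, r) (a, q)).
  rewrite twist_coef_mul /twist_coef /= eqxx !mul1r => <-.
  by rewrite xpair_eqE -natrM mulnb.
- move=> i j k m; rewrite -(twist_coef_trace (i, j) (m, k)).
  rewrite -(counit_matrix (@counit_quadratic K n)) coU.
  by rewrite xpair_eqE -natrM mulnb.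
- move=> x y; apply/(coproduct_matrixP (@quadratic_word_dual K n)
    (@coproduct_quadratic K n)) => u v u' v'.
  rewrite twist_coef_mul -coA /twist_coef mulrCA; congr (_ * (_ * _)).
  by case: v u' => [v1 v2] [u1' u2']; rewrite xpair_eqE -natrM mulnb.
- move=> [x1 x2] [y1 y2].
  rewrite (counit_matrix (@counit_quadratic K n)) twist_coef_trace.
  by rewrite coU xpair_eqE -natrM mulnb.
Qed.

End TwistedCoaction.

(* Contracting [r] with [q] in the quadratic relation and applying the trace
   relation gives [(c == m) * g a j d b l k = (a == k) * g c j d b l m], from
   which the factorisation of [g] is read off at [k = a]. *)
Lemma factorization_iff (K : fieldType) (n : nat)
    (g : 'I_n -> 'I_n -> 'I_n -> 'I_n -> 'I_n -> 'I_n -> K) :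
  (forall a b c d j k l m q r, (c == m)%:R * (d == r)%:R * g a j q b l k
     = \sum_p g c j d p l m * g a p q b r k) /\
  (forall i j k m, \sum_q g i j q k q m = (i == m)%:R * (j == k)%:R) <->
  exists theta : 'I_n -> 'I_n -> 'I_n -> 'I_n -> K,
    [/\ forall i j q k l m, g i j q k l m = (i == m)%:R * theta j q k l,
        forall i j k l r s, (\sum_p theta i j p l * theta p k r s)
          - (j == s)%:R * theta i k r l = 0
      & forall j k, \sum_q theta j q k q = (j == k)%:R].
Proof.
split=> [[gM gT]|[theta [gE thM thT]]].
  have contracted a b c d j k l m :
      (c == m)%:R * g a j d b l k = (a == k)%:R * g c j d b l m.
    transitivity (\sum_q (c == m)%:R * (d == q)%:R * g a j q b l k).
      rewrite (bigD1 d) //= eqxx mulr1 big1 ?addr0 // => q qd.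
      by rewrite [d == q]eq_sym (negPf qd) mulr0 mul0r.
    under eq_bigr => q _ do rewrite gM.
    rewrite exchange_big (bigD1 b) //= -mulr_sumr gT eqxx mulr1 mulrC.
    rewrite [X in _ + X]big1 ?addr0 // => p pb.
    by rewrite -mulr_sumr gT (negPf pb) !mulr0.
  have gE i j q k l m : g i j q k l m = (i == m)%:R * g j j q k l j.
    by rewrite contracted eqxx mul1r.
  (* By [gE] any repeated outer index gives the same value; [j] is one already at hand, so no
     separate base index has to be chosen. *)
  exists (fun j q k l => g j j q k l j); split=> //.
  - move=> i j k l r s; apply/eqP; rewrite subr_eq0; apply/eqP.
    (* All four outer indices are set to [i]; [gE] then replaces [i] by [p] in the outer slots of
       the second factor. *)
    have := gM i r i j i i l i k s; rewrite eqxx mul1r => ->.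
    apply: eq_bigr => p _; congr (_ * _).
    by rewrite [RHS]gE eqxx mul1r.
  - by move=> j k; rewrite gT eqxx mul1r.
split=> [a b c d j k l m q r|i j k m].
  (* Both sides carry the factors [c == m] and [a == k]; what remains is this instance of the
     quadratic relation. *)
  have /eqP := thM j d q l b r; rewrite subr_eq0 => /eqP thE.
  rewrite gE mulrACA -thE mulr_sumr; apply: eq_bigr => p _.
  by rewrite !gE mulrACA.
by rewrite -(thT j k) mulr_sumr; apply: eq_bigr => q _; rewrite gE.
Qed.

Unset Implicit Arguments.

(* g i j q k l m stands for gamma_{ijq}^{klm}, theta j q k l for theta_{jq}^{kl},
   and T i j for T_i^j (lower indices first). *)
Theorem proposition1 (R : realType) (n : nat) (V : vectType R[i])
    (e : n.-tuple V) (e_basis : basis_of {:V} e)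
    (gamma : {linear (V ⊗ Ho R[i] n)%type -> (Ho R[i] n ⊗ V)%type})
    (g : 'I_n -> 'I_n -> 'I_n -> 'I_n -> 'I_n -> 'I_n -> R[i])
    (gammaE : forall i j k : 'I_n,
       gamma (tnth e i ⊗ T j k) =
       \sum_l \sum_q \sum_m g i j q k l m *: (T l q ⊗ tnth e m)) :
  left_coaction coproduct counit (twisted_coaction e gamma) <->
  exists theta : 'I_n -> 'I_n -> 'I_n -> 'I_n -> R[i],
    [/\ forall i j q k l m : 'I_n,
          g i j q k l m = (i == m)%:R * theta j q k l,
        forall i j k l r s : 'I_n,
          (\sum_p theta i j p l * theta p k r s)
          - (j == s)%:R * theta i k r l = 0
      & forall j k : 'I_n, \sum_q theta j q k q = (j == k)%:R].
Proof.
by rewrite (left_coaction_twistedP e_basis gammaE) factorization_iff.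
Qed.
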